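(* Let $n$ be a nonnegative integer and let $a,b,c$ be complex numbers such that no lower parameter of the series below is a nonpositive integer and all denominators below are nonzero. Then $${}_5F_4\left[\begin{matrix}-\frac n2,\ \frac{1-n}{2},\ 1+\frac{c+bn}{1-2b},\ -a,\ a+1\\ \frac32,\ \frac{c+bn}{1-2b},\ c+1,\ 1-c-n\end{matrix};1\right]=\frac{c(c+a+bn+b)}{(n+1)(2a+1)(c+bn)}\,\frac{(c+a+1)_n}{(c)_n}-\frac{c(c-a-1+bn+b)}{(n+1)(2a+1)(c+bn)}\,\frac{(c-a)_n}{(c)_n}.$$
   Context: $(x)_0=1$ and $(x)_n=x(x+1)\cdots(x+n-1)$ for $n\ge1$. The generalized hypergeometric series is ${}_pF_q\left[\begin{matrix}a_1,\dots,a_p\\ b_1,\dots,b_q\end{matrix};z\right]=\sum_{k\ge0}\frac{(a_1)_k\cdots(a_p)_k}{(b_1)_k\cdots(b_q)_k}\frac{z^k}{k!}$, with lower parameters $b_j\in\mathbb{C}\setminus\mathbb{Z}_{\le0}$. The series involved terminates. *)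

(* Defs.v *)
From HB Require Import structures.
From mathcomp Require Import all_boot all_order all_algebra.
From mathcomp Require Import complex.
From mathcomp Require Import all_classical all_reals all_analysis.

Set Implicit Arguments.
Unset Strict Implicit.
Unset Printing Implicit Defensive.

Import Order.TTheory GRing.Theory Num.Theory.
Import numFieldNormedType.Exports.

Local Open Scope classical_set_scope.
Local Open Scope ring_scope.
Local Open Scope complex_scope.

Definition pochhammer (R : realType) (x : R[i]) (n : nat) : R[i] :=
  \prod_(i < n) (x + i%:R).

Definition nonpositive_integer (R : realType) (x : R[i]) : Prop :=
  exists m : nat, x = - m%:R.

Definition hypergeometric_term (R : realType) (upper lower : seq R[i])
    (z : R[i]) (k : nat) : R[i] :=
  (\prod_(a <- upper) pochhammer a k) / (\prod_(b <- lower) pochhammer b k)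
  * (z ^+ k / (k`!)%:R).

(* [R[i]^o] is [R[i]] with the topology of the complex modulus. *)
Definition hypergeometric (R : realType) (upper lower : seq R[i])
    (z : R[i]) : R[i] :=
  limn (series (hypergeometric_term upper lower z : nat -> R[i]^o)).

Lemma pochhammer_opp_nat (R : realType) (m k : nat) :
  (m < k)%N -> pochhammer (- m%:R : R[i]) k = 0.
Proof.
move=> mk; rewrite /pochhammer (bigD1 (Ordinal mk)) //=.
by rewrite addNr mul0r.
Qed.

Lemma hypergeometric_terminates (R : realType) (upper lower : seq R[i])
    (z : R[i]) (m : nat) : - m%:R \in upper ->
  let u := hypergeometric_term upper lower z : nat -> R[i]^o in
  series u @ \oo --> (\sum_(k < m.+1) u k : R[i]^o).
Proof.
move=> mup u.
have u0 k : (m < k)%N -> u k = 0.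
  move=> mk; rewrite /u /hypergeometric_term.
  suff -> : \prod_(a <- upper) pochhammer a k = 0 by rewrite !mul0r.
  by rewrite (big_rem _ mup) /= pochhammer_opp_nat // mul0r.
apply: cvg_near_cst; near=> N.
have mN : (m.+1 <= N)%N by near: N; exists m.+1.
rewrite /series /= (big_cat_nat _ mN) //= big_mkord.
rewrite [X in _ + X]big_nat_cond [X in _ + X]big1 ?addr0//.
by move=> k /andP[/andP[mk _] _]; exact: u0.
Unshelve. all: by end_near. Qed.

Lemma hypergeometric_terminatingE (R : realType) (upper lower : seq R[i])
    (z : R[i]) (m : nat) : - m%:R \in upper ->
  hypergeometric upper lower z =
  \sum_(k < m.+1) hypergeometric_term upper lower z k.
Proof.
move=> mup; rewrite /hypergeometric.
apply: (@cvg_lim R[i]^o (@norm_hausdorff _ R[i]^o) nat).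
exact: hypergeometric_terminates.
Qed.

(* Main.v *)
Require Import Defs.
From mathcomp Require Import all_boot all_order all_algebra.
From mathcomp Require Import complex.
From mathcomp Require Import all_classical all_reals all_analysis.
From mathcomp Require Import ring zify.

(** The two half-integer parameters combine to
    (-n/2)_k ((1-n)/2)_k / ((3/2)_k k!) = C(n+1, 2k+1) / (n+1), the pair
    [- a], [a + 1] gives, up to the sign (-1)^k, the product
    P_k(a) = (a-k+1)_{2k} ([sym_prod a k]), and the pair [c + 1],
    [1 - c - n] gives, up to the same sign,
    c (c+k)_{n-2k} / ((c)_n (c+k)).  The remaining ratio (1+beta)_k / (beta)_k
    is ((c+k) + b(n-2k)) / (c+bn), so every term of the series is affine in
    [b] apart from the common factor 1 / (c+bn).  With
    G_N(c, k) = C(N, 2k+1) (c+k)_{N-1-2k} ([odd_coef c N k]), the part free of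
    [b] is G_{n+1}(c, k) P_k(a) and the part linear in [b] is
    (n+1) G_n(c+1, k) P_k(a): both are instances of one family
    ([hypergeometric_term_odd_coef]).

    The theorem therefore reduces to the polynomial identity [odd_sumE]:
      (2a+1) sum_k G_N(c, k) P_k(a) = (c+a)_N - (c-a-1)_N.
    Its right-hand side satisfies the recurrence
      T_{N+2}(c) = (2c+N) T_{N+1}(c) + (a(a+1) + c - c^2) T_N(c+1),
    because each of the two rising factorials does: they are exchanged by
    a -> -a-1, which fixes a(a+1).  For the sum,
    a(a+1) P_k = P_{k+1} + k(k+1) P_k turns the same recurrence into a
    relation between the coefficients of P_k ([odd_coef_rec]), which
    is Pascal's rule together with (2k+1) C(N, 2k+1) = (N-2k) C(N, 2k). *)

Import Order.TTheory GRing.Theory Num.Theory.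

Local Open Scope ring_scope.
Local Open Scope complex_scope.

Section Pochhammer.
Context {R : realType}.
Implicit Types (x : R[i]) (m n k : nat).

Lemma pochhammer0 x : pochhammer x 0 = 1.
Proof. by rewrite /pochhammer big_ord0. Qed.

Lemma pochhammerSr x n : pochhammer x n.+1 = pochhammer x n * (x + n%:R).
Proof. by rewrite /pochhammer big_ord_recr. Qed.

Lemma pochhammerD x m n :
  pochhammer x (m + n) = pochhammer x m * pochhammer (x + m%:R) n.
Proof.
rewrite /pochhammer big_split_ord /=; congr (_ * _).
by apply: eq_bigr => i _; rewrite natrD addrA.
Qed.

Lemma pochhammerSl x n : pochhammer x n.+1 = x * pochhammer (x + 1) n.
Proof.
by rewrite -add1n pochhammerD pochhammerSr pochhammer0 mul1r addr0.
Qed.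

Lemma pochhammer_neq0 x n : ~ nonpositive_integer x -> pochhammer x n != 0.
Proof.
move=> xN; apply/prodf_neq0 => i _; apply/eqP => xi0; apply: xN.
by exists i; apply/eqP; rewrite -addr_eq0 xi0.
Qed.

Lemma pochhammer_shift_ratio x k :
  x != 0 -> pochhammer x k != 0 ->
  pochhammer (1 + x) k / pochhammer x k = (x + k%:R) / x.
Proof.
move=> x0 xk0; apply/eqP; rewrite eqr_div // [1 + x]addrC mulrC.
by rewrite -pochhammerSl pochhammerSr mulrC.
Qed.

(** Reversing the order of the factors turns (1-x-n)_k into (-1)^k times the
    last [k] factors of (x)_n. *)
Lemma pochhammer_reflection x n k : (k <= n)%N ->
  pochhammer (1 - x - n%:R) k * pochhammer x (n - k)
  = (-1) ^+ k * pochhammer x n.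
Proof.
elim: k => [|k IHk] kn; first by rewrite pochhammer0 subn0 expr0 mul1r.
rewrite exprS -mulrA -IHk ?(ltnW kn)// pochhammerSr.
rewrite -(subnSK kn) pochhammerSr natrB//; ring.
Qed.

(** Up to powers of 2, the products on the two sides are (-n)_{2k} and
    (2k+1)!, both split into even and odd factors.  Beyond [n./2] both
    sides vanish. *)
Lemma pochhammer_half n k :
  (n%:R + 1) * (pochhammer (- (n%:R / 2)) k * pochhammer ((1 - n%:R) / 2) k)
  = 'C(n.+1, k.*2.+1)%:R * (pochhammer (3 / 2) k * k`!%:R) :> R[i].
Proof.
have binS m j : j.+1%:R * 'C(m, j.+1)%:R = (m%:R - j%:R) * 'C(m, j)%:R :> R[i].
  rewrite -natrM mul_bin_left natrM.
  by have [jm|mj] := leqP j m; [rewrite natrB|rewrite bin_small// !mulr0].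
elim: k => [|k IHk]; first by rewrite !pochhammer0 bin1 fact0 -[n.+1]addn1 natrD.
have eqB : 'C(n.+1, k.*2.+3)%:R * ((3 / 2 + k%:R) * k.+1%:R)
    = 'C(n.+1, k.*2.+1)%:R * ((- (n%:R / 2) + k%:R) * ((1 - n%:R) / 2 + k%:R))
    :> R[i].
  have := binS n.+1 k.*2.+1; have := binS n.+1 k.*2.+2.
  set B0 := 'C(_, k.*2.+1)%:R; set B1 := 'C(_, k.*2.+2)%:R.
  set B2 := 'C(_, _)%:R => B12 B01.
  transitivity ((k.*2.+3%:R * B2) * k.+1%:R / 2).
    by rewrite -muln2; field.
  rewrite B12; transitivity ((n.+1%:R - k.*2.+2%:R) * (k.*2.+2%:R * B1) / 4).
    by rewrite -muln2; field.
  by rewrite B01 -muln2; field.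
rewrite doubleS !pochhammerSr factS natrM.
transitivity ((n%:R + 1) *
  (pochhammer (- (n%:R / 2) : R[i]) k * pochhammer ((1 - n%:R) / 2) k) *
  ((- (n%:R / 2) + k%:R) * ((1 - n%:R) / 2 + k%:R))); first by ring.
rewrite IHk mulrAC -eqB; ring.
Qed.

End Pochhammer.

Section OddSum.
Context {R : realType}.
Implicit Types (a c : R[i]) (n k : nat).

(** This is (a-k+1)_{2k}, written so that its invariance under
    a -> -a-1 is visible factor by factor. *)
Definition sym_prod a k : R[i] := \prod_(i < k) ((a - i%:R) * (a + 1 + i%:R)).

(** When 2k+1 > n the truncated subtraction is harmless, since the binomial
    coefficient vanishes; sums over [k] may thus be extended freely. *)
Definition odd_coef c n k : R[i] :=
  'C(n, k.*2.+1)%:R * pochhammer (c + k%:R) (n - k.*2.+1).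

Lemma sym_prodS a k :
  sym_prod a k.+1 = sym_prod a k * (a * (a + 1) - k%:R * (k%:R + 1)).
Proof. rewrite /sym_prod big_ord_recr /=; congr (_ * _); ring. Qed.

Lemma pochhammer_sym_prod a k :
  pochhammer (- a) k * pochhammer (a + 1) k = (-1) ^+ k * sym_prod a k.
Proof.
elim: k => [|k IHk].
  by rewrite !pochhammer0 /sym_prod big_ord0 expr0.
rewrite !pochhammerSr sym_prodS exprS.
transitivity (pochhammer (- a) k * pochhammer (a + 1) k *
  ((- a + k%:R) * (a + 1 + k%:R))); first by ring.
rewrite IHk; ring.
Qed.

Lemma odd_coef_small c n k : (n <= k.*2)%N -> odd_coef c n k = 0.
Proof. by move=> nk; rewrite /odd_coef bin_small// mul0r. Qed.

(** This identifies the part of the series that is linear in [b] with the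
    part free of [b], in which [n.+1] and [c] become [n] and [c + 1]; it comes
    from (n+1) C(n, 2k+1) = (n-2k) C(n+1, 2k+1). *)
Lemma odd_coef_shift c n k : (k.*2 <= n)%N ->
  (n%:R + 1) * (c + k%:R) * odd_coef (c + 1) n k
  = (n%:R - k.*2%:R) * odd_coef c n.+1 k.
Proof.
rewrite leq_eqVlt => /predU1P[<-|kn].
  by rewrite odd_coef_small// subrr mulr0 mul0r.
rewrite /odd_coef subSS -(subnSK kn) pochhammerSl.
have := mul_bin_down n.+1 k.*2.+1.
rewrite subSS => /(congr1 (GRing.natmul 1 : nat -> R[i])).
rewrite !natrM natrB ?(ltnW kn)// => bE.
rewrite [RHS]mulrA -bE -natr1 [c + 1 + _]addrAC; ring.
Qed.

(** The coefficient of P_k in the recurrence of [odd_sum_rec]; the last summand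
    is what a(a+1) P_{k-1} contributes to P_k.  When all binomials are
    nonzero, each term is (c+k+1)_{n-2k-1} times a polynomial in [c], and after
    Pascal's rule the difference of the two sides is a multiple of
    (2k+1) C(n, 2k+1) - (n-2k) C(n, 2k). *)
Lemma odd_coef_rec c n k :
  odd_coef c n.+2 k = (2 * c + n%:R) * odd_coef c n.+1 k
    + (k%:R * (k%:R + 1) + c - c ^+ 2) * odd_coef (c + 1) n k
    + (if k is j.+1 then odd_coef (c + 1) n j else 0).
Proof.
case: k => [|k].
  rewrite /odd_coef !bin1 !addr0 !subn1 /=; case: n => [|n] /=.
    by rewrite pochhammerSr pochhammer0; ring.
  rewrite [pochhammer c n.+2]pochhammerSr pochhammerSl; ring.
(* The truncated exponents force the cases n <= 2k, n = 2k+1 and n = 2k+2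
   (for the index k.+1) to be treated apart from the generic one. *)
have [nk|] := leqP n k.*2.
  by rewrite !odd_coef_small ?doubleS; try lia; ring.
rewrite leq_eqVlt => /predU1P[<-|].
  rewrite /odd_coef doubleS !subSS !subnn !binn !bin_small//.
  by rewrite !pochhammer0; ring.
rewrite leq_eqVlt => /predU1P[<-|kn].
  rewrite /odd_coef doubleS !subSS !subnn subSnn !binn.
  rewrite !binSn !bin_small// !pochhammerSr !pochhammer0 -muln2; ring.
have [d ->] : exists d, n = (d + k.*2.+3)%N by exists (n - k.*2.+3)%N; lia.
rewrite /odd_coef doubleS.
have -> : ((d + k.*2.+3).+2 - k.*2.+3)%N = d.+2 by lia.
have -> : ((d + k.*2.+3).+1 - k.*2.+3)%N = d.+1 by lia.
have -> : (d + k.*2.+3 - k.*2.+3)%N = d by lia.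
have -> : (d + k.*2.+3 - k.*2.+1)%N = d.+2 by lia.
have -> : c + 1 + k%:R = c + k.+1%:R by ring.
rewrite [pochhammer _ d.+2]pochhammerSl pochhammerSr pochhammerSl.
have -> : c + 1 + k.+1%:R = c + k.+1%:R + 1 by ring.
have eqB : k.*2.+3%:R * 'C(d + k.*2.+3, k.*2.+3)%:R
    = d.+1%:R * 'C(d + k.*2.+3, k.*2.+2)%:R :> R[i].
  rewrite -!natrM mul_bin_left; congr (_ * _)%:R; lia.
rewrite !binS !natrD; move: eqB.
set B2 := 'C(_, k.*2.+3)%:R; set B1 := 'C(_, k.*2.+2)%:R.
set W := pochhammer _ d => eqB; apply/eqP; rewrite -subr_eq0; apply/eqP.
transitivity ((d.+1%:R * B1 - k.*2.+3%:R * B2) * (c + k.+1%:R) * W).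
  by rewrite -muln2; ring.
by rewrite eqB subrr !mul0r.
Qed.

Lemma odd_sum_rec a c n M : (n.+2 <= M.*2)%N ->
  \sum_(k < M) odd_coef c n.+2 k * sym_prod a k
  = (2 * c + n%:R) * (\sum_(k < M) odd_coef c n.+1 k * sym_prod a k)
    + (a * (a + 1) + c - c ^+ 2)
      * (\sum_(k < M) odd_coef (c + 1) n k * sym_prod a k).
Proof.
case: M => // M; rewrite doubleS !ltnS => nM.
pose u k := odd_coef (c + 1) n k * sym_prod a k.+1.
(* The bound on n makes the boundary term u M vanish. *)
have shift : \sum_(k < M.+1)
      (if nat_of_ord k is j.+1 then odd_coef (c + 1) n j else 0) * sym_prod a k
    = \sum_(k < M.+1) u k.
  rewrite big_ord_recl /= mul0r add0r big_ord_recr /= [u M]/u.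
  by rewrite odd_coef_small// mul0r addr0.
under eq_bigr do rewrite odd_coef_rec !mulrDl.
rewrite !big_split /= shift !mulr_sumr -addrA -big_split -!big_split /=.
by apply: eq_bigr => k _; rewrite /u sym_prodS; ring.
Qed.

(** Both sides satisfy the recurrence of [odd_sum_rec] in [n], with [c]
    allowed to move, and they agree for [n] = 0 and 1. *)
Lemma odd_sumE a c n M : (n <= M.*2)%N ->
  (2 * a + 1) * (\sum_(k < M) odd_coef c n k * sym_prod a k)
  = pochhammer (c + a) n - pochhammer (c - a - 1) n.
Proof.
elim/ltn_ind: n c => -[|[|n]] IHn c nM.
- by rewrite !pochhammer0 subrr big1 ?mulr0// => k _; rewrite odd_coef_small ?mul0r.
- case: M nM {IHn} => // M _; rewrite big_ord_recl big1 => [|k _]; last first.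
    by rewrite odd_coef_small ?mul0r.
  by rewrite /odd_coef /sym_prod big_ord0 !pochhammerSr !pochhammer0 bin1; ring.
rewrite odd_sum_rec// mulrDr !(mulrCA (2 * a + 1)) !IHn//; try lia.
have -> : c + 1 + a = c + a + 1 by ring.
have -> : c + 1 - a - 1 = c - a - 1 + 1 by ring.
rewrite !(pochhammerSr (c + _) n.+1) !(pochhammerSr (c - _ - _) n.+1).
rewrite !pochhammerSl -natr1; ring.
Qed.

End OddSum.

(** The ratio (1+beta)_k / (beta)_k contributes the factor
    (c + k) + b (n - 2k), whose first part cancels the c + k in the
    denominator and whose second part is absorbed by [odd_coef_shift]. *)
Lemma hypergeometric_term_odd_coef (R : realType) (n k : nat) (a b c : R[i]) :
  (k.*2 <= n)%N ->
  ~ nonpositive_integer ((c + b * n%:R) / (1 - 2 * b)) ->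
  ~ nonpositive_integer (c + 1) -> ~ nonpositive_integer (1 - c - n%:R) ->
  1 - 2 * b != 0 -> c + b * n%:R != 0 -> pochhammer c n != 0 ->
  hypergeometric_term
    [:: - (n%:R / 2); (1 - n%:R) / 2; 1 + (c + b * n%:R) / (1 - 2 * b);
        - a; a + 1]
    [:: 3 / 2; (c + b * n%:R) / (1 - 2 * b); c + 1; 1 - c - n%:R] 1 k
  = c / ((n%:R + 1) * (c + b * n%:R) * pochhammer c n)
    * ((odd_coef c n.+1 k + (n%:R + 1) * b * odd_coef (c + 1) n k)
       * sym_prod a k).
Proof.
move=> kn okbeta okc1 okcn b0 cbn0 cn0.
set beta := (c + b * n%:R) / (1 - 2 * b) in okbeta *.
have beta0 : beta != 0 by rewrite mulf_neq0 ?invr_eq0.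
have c1k0 := pochhammer_neq0 _ k okc1.
have cnk0 := pochhammer_neq0 _ k okcn.
have betak0 := pochhammer_neq0 _ k okbeta.
have h0 : pochhammer (3 / 2 : R[i]) k != 0.
  apply: pochhammer_neq0 => -[m] /eqP.
  by rewrite -addr_eq0 gt_eqF// ltr_pwDl.
have f0 : k`!%:R != 0 :> R[i] by rewrite pnatr_eq0 -lt0n fact_gt0.
have n10 : n%:R + 1 != 0 :> R[i] by rewrite natr1 pnatr_eq0.
rewrite /hypergeometric_term !big_cons !big_nil !mulr1 expr1n.
(* The factors are grouped into the three ratios that simplify separately. *)
transitivity (((n%:R + 1) *
   (pochhammer (- (n%:R / 2)) k * pochhammer ((1 - n%:R) / 2) k)
     / (pochhammer (3 / 2) k * k`!%:R) / (n%:R + 1))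
   * (pochhammer (1 + beta) k / pochhammer beta k)
   * ((pochhammer (- a) k * pochhammer (a + 1) k)
      / (pochhammer (c + 1) k * pochhammer (1 - c - n%:R) k))).
  field; rewrite ?f0 ?n10 ?h0 ?c1k0 ?cnk0 ?betak0//.
rewrite pochhammer_half mulfK ?mulf_neq0//.
rewrite pochhammer_shift_ratio// pochhammer_sym_prod.
(* For n = 0 this is the hypothesis on c + b n; otherwise c divides (c)_n. *)
have c0 : c != 0.
  apply/eqP => c_eq0; case: (n) cn0 cbn0 => [|m] /eqP; rewrite c_eq0.
    by rewrite mulr0 addr0 eqxx.
  by rewrite pochhammerSl mul0r.
have ck0 : c + k%:R != 0.
  case: (k) c1k0 => [|j]; first by rewrite addr0.
  by rewrite pochhammerSr mulf_eq0 negb_or -addrA nat1r => /andP[].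
(* (1-c-n)_k (c)_{n-k} = (-1)^k (c)_n, where (c)_{n-k} splits at k and
   (c)_k (c+k) = c (c+1)_k. *)
have den : (-1) ^+ k / (pochhammer (c + 1) k * pochhammer (1 - c - n%:R) k)
    = c * pochhammer (c + k%:R) (n - k.*2) / (pochhammer c n * (c + k%:R)).
  apply/eqP; rewrite eqr_div ?mulf_neq0// mulrA -pochhammer_reflection; last lia.
  have -> : (n - k)%N = (k + (n - k.*2))%N by lia.
  have := pochhammerSl c k; rewrite pochhammerSr pochhammerD => cc.
  set p := pochhammer (1 - c - n%:R) k; set w := pochhammer (c + k%:R) _.
  transitivity (p * w * (pochhammer c k * (c + k%:R))
                == c * w * (pochhammer (c + 1) k * p)).
    by congr (_ == _); ring.
  by rewrite cc; apply/eqP; ring.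
rewrite [(-1) ^+ k * _]mulrC -[sym_prod a k * _ / _]mulrA den.
have -> : odd_coef (c + 1) n k
    = (n%:R - k.*2%:R) * odd_coef c n.+1 k / ((n%:R + 1) * (c + k%:R)).
  by rewrite -odd_coef_shift// [RHS]mulrC mulKf// mulf_neq0.
rewrite /odd_coef subSS /beta -muln2; field.
by rewrite ck0 n10 cn0 cbn0 b0.
Qed.

Theorem proposition5p2 (R : realType) (n : nat) (a b c : R[i])
  (lower_ok : forall d : R[i],
     d \in [:: 3 / 2; (c + b * n%:R) / (1 - 2 * b); c + 1; 1 - c - n%:R] ->
     ~ nonpositive_integer d)
  (den_b : 1 - 2 * b != 0)
  (den_a : 2 * a + 1 != 0)
  (den_cbn : c + b * n%:R != 0)
  (den_cn : pochhammer c n != 0) :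
  hypergeometric
    [:: - (n%:R / 2); (1 - n%:R) / 2; 1 + (c + b * n%:R) / (1 - 2 * b);
        - a; a + 1]
    [:: 3 / 2; (c + b * n%:R) / (1 - 2 * b); c + 1; 1 - c - n%:R]
    1
  = c * (c + a + b * n%:R + b)
      / ((n%:R + 1) * (2 * a + 1) * (c + b * n%:R))
      * (pochhammer (c + a + 1) n / pochhammer c n)
    - c * (c - a - 1 + b * n%:R + b)
      / ((n%:R + 1) * (2 * a + 1) * (c + b * n%:R))
      * (pochhammer (c - a) n / pochhammer c n).
Proof.
have n10 : n%:R + 1 != 0 :> R[i] by rewrite natr1 pnatr_eq0.
(* Whichever of - n / 2 and (1 - n) / 2 is an integer equals - n./2. *)
rewrite (@hypergeometric_terminatingE R _ _ _ n./2); last first.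
  have nE : n%:R = (odd n)%:R + 2 * n./2%:R :> R[i].
    by rewrite -natrM mul2n -natrD odd_double_half.
  rewrite nE !inE; case: (odd n) => /=.
    by apply/orP; right; apply/orP; left; apply/eqP; field.
  by apply/orP; left; apply/eqP; field.
rewrite (eq_bigr (fun k : 'I_n./2.+1 =>
    c / ((n%:R + 1) * (c + b * n%:R) * pochhammer c n)
    * ((odd_coef c n.+1 k + (n%:R + 1) * b * odd_coef (c + 1) n k)
       * sym_prod a k))); last first.
  move=> k _; apply: hypergeometric_term_odd_coef => //.
  - have := ltn_ord k; lia.
  - by apply: lower_ok; rewrite !inE eqxx !orbT.
  - by apply: lower_ok; rewrite !inE eqxx !orbT.
  - by apply: lower_ok; rewrite !inE eqxx !orbT.
rewrite -mulr_sumr.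
under eq_bigr do rewrite mulrDl -mulrA.
rewrite big_split /= -mulr_sumr.
have hn : (n.+1 <= n./2.+1.*2)%N by lia.
have S1 := odd_sumE a c n.+1 n./2.+1 hn.
have S2 := odd_sumE a (c + 1) n n./2.+1 (ltnW hn).
move: S1 S2; set s1 := \sum_(_ < _) _; set s2 := \sum_(_ < _) _ => S1 S2.
have -> : s1
    = (pochhammer (c + a) n.+1 - pochhammer (c - a - 1) n.+1) / (2 * a + 1).
  by rewrite -S1 mulrC mulKf.
have -> : s2
    = (pochhammer (c + 1 + a) n - pochhammer (c + 1 - a - 1) n) / (2 * a + 1).
  by rewrite -S2 mulrC mulKf.
have -> : c + 1 + a = c + a + 1 by ring.
have -> : c + 1 - a - 1 = c - a by ring.
rewrite !pochhammerSl.
have -> : c - a - 1 + 1 = c - a by ring.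
by field; rewrite ?n10 ?den_a ?den_cbn ?den_cn.
Qed.
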